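(* Consider the bulk Peng-Robinson Helmholtz free energy density $f_b(n,T)$ for $0<n<1/b$, $T>0$. Then $f_b=f_b^{\mathrm{convex}}+f_b^{\mathrm{concave}}$, where $$f_b^{\mathrm{convex}}(n,T)=f_b^{\mathrm{ideal}}(n,T)+f_b^{\mathrm{repulsion}}(n,T)$$ is a convex function of $n$ and $$f_b^{\mathrm{concave}}(n,T)=f_b^{\mathrm{attraction}}(n,T)$$ is a concave function of $n$ (for each fixed $T$). Moreover, $f_b$ is concave with respect to the temperature $T$ (for each fixed $n$).
   Context: Constants: gas constant $R>0$, critical temperature $T_c>0$, critical pressure $P_c>0$, acentric factor $\omega$, reference values $T_0=298.15$ K, $P_0=1$ bar, $\vartheta_0=-2478.95687512$ J/mol, and heat capacity coefficients $\alpha_0,\dots,\alpha_3$. Put $T_r=T/T_c$, $$a(T)=0.45724\frac{R^2T_c^2}{P_c}\big[1+m(1-\sqrt{T_r})\big]^2,\qquad b=0.07780\frac{RT_c}{P_c},$$ where $m=0.37464+1.54226\omega-0.26992\omega^2$ if $\omega\le 0.49$ and $m=0.379642+1.485030\omega-0.164423\omega^2+0.016666\omega^3$ if $\omega>0.49$; it is assumed that $m>0$. $\psi_p(T)=\sum_{i=0}^3\alpha_iT^i$ is the molar heat capacity of the ideal gas at constant pressure, and it is assumed (thermodynamic relation for ideal gases) that $\psi_p=R+\psi_v$ with $\psi_v>0$ the molar heat capacity at constant volume. $f_b=f_b^{\mathrm{ideal}}+f_b^{\mathrm{repulsion}}+f_b^{\mathrm{attraction}}$ with $$f_b^{\mathrm{ideal}}=n\vartheta_0+n\sum_{i=0}^3\alpha_i\frac{T^{i+1}-T_0^{i+1}}{i+1}-nR(T-T_0)-nRT\ln\Big(\frac{P_0}{nRT}\Big)-nT\int_{T_0}^T\frac{\psi_p(\tau)}{\tau}d\tau,$$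 $$f_b^{\mathrm{repulsion}}=-nRT\ln(1-bn),\qquad f_b^{\mathrm{attraction}}=\frac{a(T)n}{2\sqrt2\,b}\ln\Big(\frac{1+(1-\sqrt2)bn}{1+(1+\sqrt2)bn}\Big).$$ *)

(* Defs.v *)
From Stdlib Require Import Reals.
From Coquelicot Require Import Coquelicot.
Open Scope R_scope.

Definition convex_on (D : R -> Prop) (f : R -> R) : Prop :=
  forall x y t : R, D x -> D y -> 0 <= t <= 1 ->
    f (t * x + (1 - t) * y) <= t * f x + (1 - t) * f y.

Definition concave_on (D : R -> Prop) (f : R -> R) : Prop :=
  forall x y t : R, D x -> D y -> 0 <= t <= 1 ->
    t * f x + (1 - t) * f y <= f (t * x + (1 - t) * y).

(* All quantities are in SI units (K, Pa, J/mol); in particular P0 is 1 bar. *)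
Definition T0 : R := 298.15.
Definition P0 : R := 100000.
Definition theta0 : R := -2478.95687512.

(* Sign conditions on these data are hypotheses of the theorem.
   Only [alpha 0], ..., [alpha 3] are ever used. *)
Record fluid : Type := Fluid {
  gasR : R;
  Tc : R;
  Pc : R;
  omega : R;
  alpha : nat -> R
}.

Definition m_coef (F : fluid) : R :=
  let w := omega F in
  if Rle_dec w 0.49
  then 0.37464 + 1.54226 * w - 0.26992 * w ^ 2
  else 0.379642 + 1.485030 * w - 0.164423 * w ^ 2 + 0.016666 * w ^ 3.

Definition a_coef (F : fluid) (T : R) : R :=
  0.45724 * (gasR F ^ 2 * Tc F ^ 2 / Pc F)
  * (1 + m_coef F * (1 - sqrt (T / Tc F))) ^ 2.

Definition b_coef (F : fluid) : R := 0.07780 * (gasR F * Tc F / Pc F).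

Definition psi_p (F : fluid) (T : R) : R :=
  sum_f_R0 (fun i => alpha F i * T ^ i) 3.

(* [RInt] is oriented, so the case T < T0 is covered. *)
Definition f_ideal (F : fluid) (n T : R) : R :=
  n * theta0
  + n * sum_f_R0 (fun i => alpha F i * ((T ^ (i + 1) - T0 ^ (i + 1)) / INR (i + 1))) 3
  - n * gasR F * (T - T0)
  - n * gasR F * T * ln (P0 / (n * gasR F * T))
  - n * T * RInt (fun tau => psi_p F tau / tau) T0 T.

Definition f_repulsion (F : fluid) (n T : R) : R :=
  - (n * gasR F * T * ln (1 - b_coef F * n)).

Definition f_attraction (F : fluid) (n T : R) : R :=
  a_coef F T * n / (2 * sqrt 2 * b_coef F)
  * ln ((1 + (1 - sqrt 2) * b_coef F * n) / (1 + (1 + sqrt 2) * b_coef F * n)).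

Definition f_b (F : fluid) (n T : R) : R :=
  f_ideal F n T + f_repulsion F n T + f_attraction F n T.

Definition f_convex (F : fluid) (n T : R) : R := f_ideal F n T + f_repulsion F n T.

Definition f_concave (F : fluid) (n T : R) : R := f_attraction F n T.

(* Main.v *)
Require Import Defs.
From Stdlib Require Import Reals Lra.
From Coquelicot Require Import Coquelicot.
Open Scope R_scope.

(** Everything reduces to signs of second derivatives on an interval.

    For fixed [T], the ideal part is an affine function of [n] plus
    [R T n ln n], and [n ln n] has second derivative [1 / n]; the repulsion
    part is [R T] times [- n ln (1 - b n)], which is convex because both terms
    of its second derivative are positive.  The attraction part is a
    nonnegative constant times [n ln ((1 - p n) / (1 + q n))] with
    [p = (sqrt 2 - 1) b] and [q = (sqrt 2 + 1) b].  The only positive term of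
    its second derivative is [n q^2 / (1 + q n)^2], and [q n < 1 + q n] makes
    it smaller than the negative term [2 q / (1 + q n)].

    For fixed [n], the entropy integral cancels the heat capacity from the
    first temperature derivative of the ideal part, so that its second
    derivative is [n (R - psi_p) / T = - n psi_v / T < 0]: this is where
    positivity of the heat capacity at constant volume enters.  The repulsion
    part is linear in [T].  The attraction part is [a(T)] times a nonpositive
    constant, since the argument of its logarithm is less than [1]; and [a] is
    convex, because expanding its square gives an affine function of [T] minus
    a nonnegative multiple of [sqrt (T / Tc)] (here [m > 0] is used). *)

(** * Convex functions on an interval *)

Definition is_interval (D : R -> Prop) : Prop :=
  forall x y z : R, D x -> D y -> x <= z <= y -> D z.

Lemma is_interval_open_segment (a b : R) : is_interval (fun x => a < x < b).
Proof. intros x y z Hx Hy Hz; lra. Qed.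

Lemma is_interval_positive : is_interval (fun x => 0 < x).
Proof. intros x y z Hx Hy Hz; lra. Qed.

Lemma between_convex_comb (x y t : R) :
  x <= y -> 0 <= t <= 1 -> x <= t * x + (1 - t) * y <= y.
Proof. intros; split; nra. Qed.

Lemma convex_on_ext (D : R -> Prop) (f g : R -> R) :
  is_interval D -> (forall x, D x -> f x = g x) ->
  convex_on D f -> convex_on D g.
Proof.
intros HD Hfg Hf x y t Hx Hy Ht.
rewrite <- !Hfg; trivial; [now apply Hf|].
destruct (Rle_dec x y) as [Hxy|Hxy].
- exact (HD _ _ _ Hx Hy (between_convex_comb _ _ _ Hxy Ht)).
- apply (HD y x); trivial.
  replace (t * x + (1 - t) * y) with ((1 - t) * y + (1 - (1 - t)) * x) by ring.
  apply between_convex_comb; lra.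
Qed.

Lemma convex_on_plus (D : R -> Prop) (f g : R -> R) :
  convex_on D f -> convex_on D g -> convex_on D (fun x => f x + g x).
Proof.
intros Hf Hg x y t Hx Hy Ht.
specialize (Hf x y t Hx Hy Ht); specialize (Hg x y t Hx Hy Ht); lra.
Qed.

Lemma convex_on_scal (D : R -> Prop) (c : R) (f : R -> R) :
  0 <= c -> convex_on D f -> convex_on D (fun x => c * f x).
Proof.
intros Hc Hf x y t Hx Hy Ht.
specialize (Hf x y t Hx Hy Ht); nra.
Qed.

Lemma convex_on_affine (D : R -> Prop) (c d : R) :
  convex_on D (fun x => c * x + d).
Proof. intros x y t _ _ _; right; ring. Qed.

Lemma concave_on_opp (D : R -> Prop) (f : R -> R) :
  convex_on D (fun x => - f x) -> concave_on D f.
Proof.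
intros Hf x y t Hx Hy Ht.
specialize (Hf x y t Hx Hy Ht); cbv beta in Hf; lra.
Qed.

Lemma MVT_on_interval (D : R -> Prop) (f df : R -> R) (x y : R) :
  is_interval D -> (forall z, D z -> is_derive f z (df z)) ->
  D x -> D y -> x <= y ->
  exists z, x <= z <= y /\ f y - f x = df z * (y - x).
Proof.
intros HD Hdf Hx Hy Hxy.
assert (Hseg : forall z, Rmin x y <= z <= Rmax x y -> D z).
{ intros z; rewrite Rmin_left, Rmax_right by lra; intros Hz; exact (HD x y z Hx Hy Hz). }
destruct (MVT_gen f x y df) as [z [Hz Heq]].
- intros z Hz; apply Hdf, Hseg; lra.
- intros z Hz; apply continuity_pt_filterlim.
  apply (ex_derive_continuous f z); exists (df z); apply Hdf, Hseg, Hz.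
- rewrite Rmin_left, Rmax_right in Hz by lra; now exists z.
Qed.

(** The mean value theorem on either side of a convex combination [z] of
    [x <= y] gives slopes [df u] and [df v] at points [u <= z <= v], and
    [df u <= df v] by the mean value theorem for [df].  The weights
    [z - x = (1 - t) (y - x)] and [y - z = t (y - x)] turn this comparison of
    slopes into the convexity inequality. *)
Lemma convex_on_of_second_derivative (D : R -> Prop) (f df ddf : R -> R) :
  is_interval D ->
  (forall x, D x -> is_derive f x (df x)) ->
  (forall x, D x -> is_derive df x (ddf x)) ->
  (forall x, D x -> 0 <= ddf x) ->
  convex_on D f.
Proof.
intros HD Hf Hdf Hpos.
assert (Hord : forall x y t, D x -> D y -> x <= y -> 0 <= t <= 1 ->
  f (t * x + (1 - t) * y) <= t * f x + (1 - t) * f y).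
{ intros x y t Hx Hy Hxy Ht.
  pose proof (between_convex_comb x y t Hxy Ht) as Hz.
  remember (t * x + (1 - t) * y) as z eqn:Ez.
  assert (Dz : D z) by exact (HD x y z Hx Hy Hz).
  destruct (MVT_on_interval D f df x z) as [u [Hu Eu]]; trivial; [lra|].
  destruct (MVT_on_interval D f df z y) as [v [Hv Ev]]; trivial; [lra|].
  assert (Du : D u) by exact (HD x z u Hx Dz Hu).
  assert (Dv : D v) by exact (HD z y v Dz Hy Hv).
  destruct (MVT_on_interval D df ddf u v) as [w [Hw Ew]]; trivial; [lra|].
  assert (Dw : D w) by exact (HD u v w Du Dv Hw).
  assert (Huv : 0 <= df v - df u)
    by (rewrite Ew; apply Rmult_le_pos; [now apply Hpos|lra]).
  assert (Egap : t * f x + (1 - t) * f y - f z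
                 = t * (1 - t) * (y - x) * (df v - df u)).
  { replace (z - x) with ((1 - t) * (y - x)) in Eu by (rewrite Ez; ring).
    replace (y - z) with (t * (y - x)) in Ev by (rewrite Ez; ring).
    replace (t * f x + (1 - t) * f y - f z)
      with ((1 - t) * (f y - f z) - t * (f z - f x)) by ring.
    rewrite Eu, Ev; ring. }
  assert (0 <= t * (1 - t) * (y - x) * (df v - df u))
    by (repeat apply Rmult_le_pos; lra).
  lra. }
intros x y t Hx Hy Ht.
destruct (Rle_dec x y) as [Hxy|Hxy]; [now apply Hord|].
replace (t * x + (1 - t) * y) with ((1 - t) * y + (1 - (1 - t)) * x) by ring.
replace (t * f x + (1 - t) * f y)
  with ((1 - t) * f y + (1 - (1 - t)) * f x) by ring.
apply Hord; trivial; lra.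
Qed.

(** * Convexity in the molar density *)

Lemma convex_on_xlnx (b : R) :
  convex_on (fun x => 0 < x < b) (fun x => x * ln x).
Proof.
apply (convex_on_of_second_derivative _ _ (fun x => ln x + 1) (fun x => / x)).
- apply is_interval_open_segment.
- intros x Hx; auto_derive; [lra|field; lra].
- intros x Hx; auto_derive; [lra|field; lra].
- intros x Hx; apply Rlt_le, Rinv_0_lt_compat; lra.
Qed.

Lemma mul_lt_1_of_lt_inv (b n : R) : 0 < b -> n < 1 / b -> b * n < 1.
Proof.
intros Hb Hn.
replace 1 with (b * (1 / b)) by (field; lra).
now apply Rmult_lt_compat_l.
Qed.

Lemma convex_on_repulsion_kernel (b : R) : 0 < b ->
  convex_on (fun n => 0 < n < 1 / b) (fun n => - (n * ln (1 - b * n))).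
Proof.
intros Hb.
apply (convex_on_of_second_derivative _ _
  (fun n => - ln (1 - b * n) + n * b / (1 - b * n))
  (fun n => 2 * (b / (1 - b * n)) + n * (b / (1 - b * n)) ^ 2)).
- apply is_interval_open_segment.
- intros n [Hn0 Hn]; apply mul_lt_1_of_lt_inv in Hn; trivial.
  auto_derive; [lra|unfold Rminus; field; lra].
- intros n [Hn0 Hn]; apply mul_lt_1_of_lt_inv in Hn; trivial.
  auto_derive; [lra|field; lra].
- intros n [Hn0 Hn]; apply mul_lt_1_of_lt_inv in Hn; trivial.
  assert (Hu : 0 < b / (1 - b * n)) by (apply Rdiv_lt_0_compat; lra).
  pose proof (Rmult_lt_0_compat _ _ Hn0 (pow_lt _ 2 Hu)); lra.
Qed.

(** The second derivative is [2 u + n u^2 + v (2 - n v)] with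
    [u = p / (1 - p n)] and [v = q / (1 + q n)], and [n v <= 1]. *)
Lemma convex_on_attraction_kernel (p q c : R) : 0 < p -> 0 < q -> p * c <= 1 ->
  convex_on (fun n => 0 < n < c)
    (fun n => - (n * ln ((1 - p * n) / (1 + q * n)))).
Proof.
intros Hp Hq Hpc.
assert (Hpn : forall n, 0 < n < c -> 0 < 1 - p * n) by (intros; nra).
assert (Hqn : forall n, 0 < n < c -> 0 < 1 + q * n) by (intros; nra).
apply (convex_on_ext _
  (fun n => - (n * (ln (1 - p * n) - ln (1 + q * n))))).
{ apply is_interval_open_segment. }
{ intros n Hn; rewrite ln_div; auto. }
apply (convex_on_of_second_derivative _ _
  (fun n => - (ln (1 - p * n) - ln (1 + q * n))
            + n * (p / (1 - p * n) + q / (1 + q * n)))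
  (fun n => 2 * (p / (1 - p * n)) + n * (p / (1 - p * n)) ^ 2
            + q / (1 + q * n) * (2 - n * (q / (1 + q * n))))).
- apply is_interval_open_segment.
- intros n Hn; specialize (Hpn n Hn); specialize (Hqn n Hn).
  auto_derive; [lra|unfold Rminus; field; lra].
- intros n Hn; specialize (Hpn n Hn); specialize (Hqn n Hn).
  auto_derive; [lra|field; lra].
- intros n Hn; specialize (Hpn n Hn); specialize (Hqn n Hn).
  assert (Hu : 0 < p / (1 - p * n)) by (apply Rdiv_lt_0_compat; lra).
  pose proof (Rmult_lt_0_compat _ _ (proj1 Hn) (pow_lt _ 2 Hu)).
  assert (Hv : 0 < q / (1 + q * n)) by (apply Rdiv_lt_0_compat; lra).
  assert (Hnv : 1 - n * (q / (1 + q * n)) = / (1 + q * n)) by (field; lra).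
  pose proof (Rinv_0_lt_compat _ Hqn) as Hinv.
  apply Rplus_le_le_0_compat; [lra|apply Rmult_le_pos; lra].
Qed.

Lemma b_coef_pos (F : fluid) :
  0 < gasR F -> 0 < Tc F -> 0 < Pc F -> 0 < b_coef F.
Proof.
intros HR HTc HPc; unfold b_coef.
apply Rmult_lt_0_compat; [lra|].
apply Rdiv_lt_0_compat; trivial; now apply Rmult_lt_0_compat.
Qed.

Lemma a_scale_pos (F : fluid) : 0 < gasR F -> 0 < Tc F -> 0 < Pc F ->
  0 < 0.45724 * (gasR F ^ 2 * Tc F ^ 2 / Pc F).
Proof.
intros HR HTc HPc.
apply Rmult_lt_0_compat; [lra|].
apply Rdiv_lt_0_compat; trivial; apply Rmult_lt_0_compat; now apply pow_lt.
Qed.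

Lemma a_coef_nonneg (F : fluid) (T : R) :
  0 < gasR F -> 0 < Tc F -> 0 < Pc F -> 0 <= a_coef F T.
Proof.
intros HR HTc HPc; unfold a_coef.
apply Rmult_le_pos; [now apply Rlt_le, a_scale_pos|apply pow2_ge_0].
Qed.

Lemma sqrt2_bounds : 1 < sqrt 2 < 2.
Proof.
pose proof (sqrt_sqrt 2 ltac:(lra)); pose proof (sqrt_pos 2); split; nra.
Qed.

Lemma f_convex_convex_density (F : fluid) (T : R) :
  0 < gasR F -> 0 < b_coef F -> 0 < T ->
  convex_on (fun n => 0 < n < 1 / b_coef F) (fun n => f_convex F n T).
Proof.
intros HR Hb HT.
assert (HRT : 0 < gasR F * T) by now apply Rmult_lt_0_compat.
(* The coefficient of [n], including the constant
   part of [- ln (P0 / (n R T)) = ln n + ln (R T) - ln P0]. *)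
pose (slope := theta0
  + sum_f_R0 (fun i => alpha F i * ((T ^ (i + 1) - T0 ^ (i + 1)) / INR (i + 1))) 3
  - gasR F * (T - T0)
  - gasR F * T * (ln P0 - ln (gasR F * T))
  - T * RInt (fun tau => psi_p F tau / tau) T0 T).
apply (convex_on_ext _ (fun n => (slope * n + 0)
  + (gasR F * T) * (n * ln n + - (n * ln (1 - b_coef F * n))))).
- apply is_interval_open_segment.
- intros n Hn; unfold f_convex, f_ideal, f_repulsion, slope.
  assert (HP0 : 0 < P0) by (unfold P0; lra).
  rewrite (Rmult_assoc n (gasR F) T), ln_div, (ln_mult n); try lra.
  apply Rmult_lt_0_compat; lra.
- apply convex_on_plus; [apply convex_on_affine|].
  apply convex_on_scal; [lra|].
  apply convex_on_plus;
    [apply convex_on_xlnx|now apply convex_on_repulsion_kernel].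
Qed.

Lemma f_concave_concave_density (F : fluid) (T : R) :
  0 < gasR F -> 0 < Tc F -> 0 < Pc F ->
  concave_on (fun n => 0 < n < 1 / b_coef F) (fun n => f_concave F n T).
Proof.
intros HR HTc HPc.
pose proof (b_coef_pos F HR HTc HPc) as Hb.
pose proof sqrt2_bounds as H2.
apply concave_on_opp.
apply (convex_on_ext _ (fun n => a_coef F T / (2 * sqrt 2 * b_coef F)
  * - (n * ln ((1 - ((sqrt 2 - 1) * b_coef F) * n)
               / (1 + ((1 + sqrt 2) * b_coef F) * n))))).
- apply is_interval_open_segment.
- intros n _; unfold f_concave, f_attraction.
  replace (1 - (sqrt 2 - 1) * b_coef F * n)
    with (1 + (1 - sqrt 2) * b_coef F * n) by ring.
  field; lra.
- apply convex_on_scal.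
  + apply Rmult_le_pos; [now apply a_coef_nonneg|].
    apply Rlt_le, Rinv_0_lt_compat; nra.
  + apply convex_on_attraction_kernel; try nra.
    replace ((sqrt 2 - 1) * b_coef F * (1 / b_coef F)) with (sqrt 2 - 1)
      by (field; lra).
    lra.
Qed.

(** * Concavity in the temperature *)

Lemma is_derive_entropy_integral (F : fluid) (T : R) : 0 < T ->
  is_derive (fun T => RInt (fun tau => psi_p F tau / tau) T0 T) T (psi_p F T / T).
Proof.
intros HT.
assert (Hcont : forall z, 0 < z -> continuous (fun tau => psi_p F tau / tau) z).
{ intros z Hz; apply (ex_derive_continuous (fun tau => psi_p F tau / tau)).
  unfold psi_p; simpl; auto_derive; lra. }
apply (is_derive_RInt (fun tau => psi_p F tau / tau) _ T0).
- exists (mkposreal T HT); intros y Hy.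
  apply (RInt_correct (fun tau => psi_p F tau / tau)).
  apply (ex_RInt_continuous (fun tau => psi_p F tau / tau)).
  intros z Hz; apply Hcont.
  change (Rabs (y - T) < T) in Hy; apply Rabs_def2 in Hy.
  apply Rlt_le_trans with (2 := proj1 Hz).
  apply Rmin_glb_lt; [unfold T0|]; lra.
- now apply Hcont.
Qed.

Lemma is_derive_enthalpy (F : fluid) (T : R) :
  is_derive
    (fun T => sum_f_R0 (fun i => alpha F i * ((T ^ (i + 1) - T0 ^ (i + 1)) / INR (i + 1))) 3)
    T (psi_p F T).
Proof. unfold psi_p; simpl; auto_derive; [trivial|field]. Qed.

(** With [H' = c] and [S' = c / T], the function below is the enthalpy minus
    [T] times the entropy of an ideal gas.  Its derivative is minus an entropy
    in which [c] occurs only through [S], and differentiating once more leaves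
    [n (R - c) / T]. *)
Lemma convex_on_opp_ideal_gas (n r P E E0 : R) (H S c : R -> R) :
  0 < n -> 0 < r -> 0 < P ->
  (forall T, 0 < T -> is_derive H T (c T)) ->
  (forall T, 0 < T -> is_derive S T (c T / T)) ->
  (forall T, 0 < T -> r <= c T) ->
  convex_on (fun T => 0 < T)
    (fun T => - (n * E + n * H T - n * r * (T - E0)
                 - n * r * T * ln (P / (n * r * T)) - n * T * S T)).
Proof.
intros Hn Hr HP HH HS Hc.
assert (Hnr : 0 < n * r) by now apply Rmult_lt_0_compat.
assert (HH' : forall T, 0 < T -> Derive (fun T => H T) T = c T)
  by (intros; now apply is_derive_unique, HH).
assert (HS' : forall T, 0 < T -> Derive (fun T => S T) T = c T / T)
  by (intros; now apply is_derive_unique, HS).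
assert (Hlog : forall T, 0 < T -> 0 < n * r * T)
  by (intros; now apply Rmult_lt_0_compat).
apply (convex_on_of_second_derivative _ _
  (fun T => n * r * ln (P / (n * r * T)) + n * S T)
  (fun T => n * ((c T - r) / T))).
- apply is_interval_positive.
- intros T HT; specialize (Hlog T HT).
  assert (0 < P / (n * r * T)) by now apply Rdiv_lt_0_compat.
  auto_derive.
  + repeat split; trivial; try lra; [exists (c T)|exists (c T / T)]; auto.
  + rewrite HH', HS' by exact HT.
    unfold Rdiv; field; lra.
- intros T HT; specialize (Hlog T HT).
  assert (0 < P / (n * r * T)) by now apply Rdiv_lt_0_compat.
  auto_derive.
  + repeat split; trivial; try lra; exists (c T / T); auto.
  + rewrite HS' by exact HT.
    field; lra.
- intros T HT; specialize (Hc T HT).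
  apply Rmult_le_pos; [lra|].
  apply Rmult_le_pos; [lra|now apply Rlt_le, Rinv_0_lt_compat].
Qed.

Lemma convex_on_opp_sqrt (c : R) : 0 < c ->
  convex_on (fun T => 0 < T) (fun T => - sqrt (T / c)).
Proof.
intros Hc.
apply (convex_on_of_second_derivative _ _
  (fun T => - / (2 * c * sqrt (T / c)))
  (fun T => / (4 * c ^ 2 * sqrt (T / c) ^ 3))).
- apply is_interval_positive.
- intros T HT.
  assert (HTc : 0 < T / c) by now apply Rdiv_lt_0_compat.
  pose proof (sqrt_lt_R0 _ HTc).
  auto_derive; [lra|unfold Rdiv in *; field; lra].
- intros T HT.
  assert (HTc : 0 < T / c) by now apply Rdiv_lt_0_compat.
  pose proof (sqrt_lt_R0 _ HTc).
  auto_derive.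
  + repeat split; trivial; nra.
  + unfold Rdiv in *; field; lra.
- intros T HT.
  assert (HTc : 0 < T / c) by now apply Rdiv_lt_0_compat.
  pose proof (sqrt_lt_R0 _ HTc).
  apply Rlt_le, Rinv_0_lt_compat, Rmult_lt_0_compat.
  + assert (0 < c ^ 2) by now apply pow_lt.
    lra.
  + now apply pow_lt.
Qed.

(** Squaring does not preserve convexity where [1 + m (1 - sqrt (T / Tc))] is
    negative, so the square is expanded instead, using
    [sqrt (T / Tc) ^ 2 = T / Tc]. *)
Lemma convex_on_a_coef (F : fluid) :
  0 < gasR F -> 0 < Tc F -> 0 < Pc F -> 0 < m_coef F ->
  convex_on (fun T => 0 < T) (a_coef F).
Proof.
intros HR HTc HPc Hm.
pose proof (a_scale_pos F HR HTc HPc) as HK.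
pose (m := m_coef F).
apply (convex_on_ext _ (fun T => 0.45724 * (gasR F ^ 2 * Tc F ^ 2 / Pc F)
  * ((m ^ 2 / Tc F * T + (1 + m) ^ 2)
     + 2 * m * (1 + m) * - sqrt (T / Tc F)))).
- apply is_interval_positive.
- intros T HT; unfold a_coef; fold m; f_equal.
  assert (HTr : 0 <= T / Tc F) by now apply Rlt_le, Rdiv_lt_0_compat.
  replace (m ^ 2 / Tc F * T) with (m ^ 2 * (sqrt (T / Tc F) * sqrt (T / Tc F))).
  + ring.
  + rewrite (sqrt_sqrt _ HTr); field; lra.
- apply convex_on_scal; [lra|].
  apply convex_on_plus; [apply convex_on_affine|].
  apply convex_on_scal; [unfold m; nra|now apply convex_on_opp_sqrt].
Qed.

Lemma attraction_log_nonpos (b n : R) : 0 < b -> 0 < n < 1 / b ->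
  ln ((1 + (1 - sqrt 2) * b * n) / (1 + (1 + sqrt 2) * b * n)) <= 0.
Proof.
intros Hb [Hn0 Hn]; apply mul_lt_1_of_lt_inv in Hn; trivial.
pose proof sqrt2_bounds as H2.
assert (Hbn : 0 < b * n) by now apply Rmult_lt_0_compat.
assert (Hnum : 0 < 1 + (1 - sqrt 2) * b * n) by nra.
assert (Hden : 0 < 1 + (1 + sqrt 2) * b * n) by nra.
rewrite ln_div by assumption.
assert (ln (1 + (1 - sqrt 2) * b * n) < ln (1 + (1 + sqrt 2) * b * n))
  by (apply ln_increasing; nra).
lra.
Qed.

Lemma f_b_concave_temperature (F : fluid) (n : R) :
  0 < gasR F -> 0 < Tc F -> 0 < Pc F -> 0 < m_coef F ->
  (forall T, 0 < T -> gasR F <= psi_p F T) ->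
  0 < n < 1 / b_coef F ->
  concave_on (fun T => 0 < T) (fun T => f_b F n T).
Proof.
intros HR HTc HPc Hm Hpsi Hn.
pose proof (b_coef_pos F HR HTc HPc) as Hb.
pose proof sqrt2_bounds as H2.
apply concave_on_opp.
apply (convex_on_ext _ (fun T => - f_ideal F n T
  + ((n * gasR F * ln (1 - b_coef F * n) * T + 0)
     + (n / (2 * sqrt 2 * b_coef F)
        * - ln ((1 + (1 - sqrt 2) * b_coef F * n)
                / (1 + (1 + sqrt 2) * b_coef F * n))) * a_coef F T))).
- apply is_interval_positive.
- intros T _; unfold f_b, f_repulsion, f_attraction; field; lra.
- apply convex_on_plus.
  + apply (convex_on_opp_ideal_gas n (gasR F) P0 theta0 T0 _ _ (psi_p F));
      [lra|exact HR|unfold P0; lra| | |exact Hpsi].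
    * intros T _; apply is_derive_enthalpy.
    * apply is_derive_entropy_integral.
  + apply convex_on_plus; [apply convex_on_affine|].
    apply convex_on_scal; [|now apply convex_on_a_coef].
    apply Rmult_le_pos.
    * apply Rlt_le, Rdiv_lt_0_compat; [lra|nra].
    * pose proof (attraction_log_nonpos _ _ Hb Hn); lra.
Qed.

Theorem lemma4p1 (F : fluid) (psi_v : R -> R)
  (hR : 0 < gasR F) (hTc : 0 < Tc F) (hPc : 0 < Pc F) (hm : 0 < m_coef F)
  (hpsi : forall T : R, 0 < T -> psi_p F T = gasR F + psi_v T)
  (hpsi_v : forall T : R, 0 < T -> 0 < psi_v T) :
  (forall n T : R, 0 < n < 1 / b_coef F -> 0 < T ->
     f_b F n T = f_convex F n T + f_concave F n T) /\
  (forall T : R, 0 < T ->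
     convex_on (fun n => 0 < n < 1 / b_coef F) (fun n => f_convex F n T)) /\
  (forall T : R, 0 < T ->
     concave_on (fun n => 0 < n < 1 / b_coef F) (fun n => f_concave F n T)) /\
  (forall n : R, 0 < n < 1 / b_coef F ->
     concave_on (fun T => 0 < T) (fun T => f_b F n T)).
Proof.
split; [|split; [|split]].
- reflexivity.
- intros T HT; apply f_convex_convex_density; trivial; now apply b_coef_pos.
- intros T _; now apply f_concave_concave_density.
- intros n Hn; apply f_b_concave_temperature; trivial.
  intros T HT; rewrite (hpsi T HT); specialize (hpsi_v T HT); lra.
Qed.
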